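(* Let $q$ be a prime power, $n>1$ an integer, and let $\mathbf{P}$ be a non-trivial partition of $V_n(q)$. Let $t$ be the minimum of the dimensions of the components of $\mathbf{P}$. Then the number of components of $\mathbf{P}$ of dimension $t$ is greater than or equal to $q+t$.
   Context: $V_n(q)$ denotes the $n$-dimensional vector space over the finite field $\mathbb{F}_q$ with $q$ elements. A partition of $V_n(q)$ is a (finite) set $\mathbf{P}=\{V_1,\dots,V_r\}$ of non-zero subspaces (called components) of $V_n(q)$ such that $\bigcup_{i=1}^r V_i=V_n(q)$ and $V_i\cap V_j=\{0\}$ for $i\neq j$. It is non-trivial if $r\ge 2$. *)

(* Defs.v *)
From HB Require Import structures.
From mathcomp Require Import all_boot all_order all_algebra all_field.
From mathcomp Require Import finmap.

Set Implicit Arguments.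
Unset Strict Implicit.
Unset Printing Implicit Defensive.

Local Open Scope fset_scope.

Definition vspace_partition (F : fieldType) (V : vectType F)
    (P : {fset {vspace V}}) : Prop :=
  [/\ forall U : {vspace V}, U \in P -> U <> 0%VS,
      forall v : V, exists2 U : {vspace V}, U \in P & v \in U
    & forall U W : {vspace V}, U \in P -> W \in P -> U <> W ->
        (U :&: W)%VS = 0%VS].

Definition nontrivial_partition (F : fieldType) (V : vectType F)
    (P : {fset {vspace V}}) : Prop :=
  vspace_partition P /\ 2 <= #|` P|.

Definition is_min_dim (F : fieldType) (V : vectType F)
    (P : {fset {vspace V}}) (t : nat) : Prop :=
  (exists2 U : {vspace V}, U \in P & \dim U = t) /\
  (forall U : {vspace V}, U \in P -> t <= \dim U).

(* Main.v *)
From HB Require Import structures.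
Require Import Defs.
From mathcomp Require Import all_boot all_order all_algebra all_field.
From mathcomp Require Import finmap.
From mathcomp Require Import zify.
Set Implicit Arguments.
Unset Strict Implicit.
Unset Printing Implicit Defensive.

Import GRing.Theory.

(** Let T be the set of components of minimal dimension t, m its size, and n
    the dimension of V. The proof gives the stronger bound m > q ^ t, from
    which q + t <= m follows because q ^ t + 1 >= q + t.

    For a linear form f on V, let x f be the number of components of T on
    which f vanishes.

    - Divisibility. If f is nonzero, the affine hyperplane f = 1 misses 0, so
      the components cut it into disjoint pieces: a component U contributes
      q ^ (dim U - 1) points if f is nonzero on U, and none otherwise.
      Reducing the resulting equation, whose total is q ^ (n - 1), modulo
      q ^ t leaves only the components of dimension exactly t, and shows that
      q divides m - x f ([dvdn_tail_outside]).

    - Moments. A form vanishes on U and W iff it vanishes on U + W, and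
      components of T are pairwise independent, so the sums of x f and of
      (x f) ^ 2 over all forms are known exactly ([first_moment],
      [second_moment]); the zero form contributes m and m ^ 2.

    If q does not divide m, then x f is never 0, hence at least 1 everywhere;
    if q divides m, then q divides x f, and (x f) ^ 2 >= q * x f for f
    nonzero. When m <= q ^ t, the first inequality contradicts the first
    moment and the second one contradicts the second
    ([divisible_spread_gt]). *)

(** * Arithmetic of the two moments *)

(** Here [Q] stands for q ^ t and [b] for q ^ (n - 2t), while [A1] and [A2]
    are the moments without the zero form. Already 2 * A1 > A2, since
    2 * A1 - A2 = m * (b * (Q - m + 1) + m - 2) with m >= 2. *)
Lemma second_moment_lt (q m b Q A1 A2 : nat) :
    1 < q -> q <= m <= Q -> 0 < b ->
    m + A1 = m * (b * Q) -> m ^ 2 + A2 = m * (Q + m.-1) * b ->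
  A2 < q * A1.
Proof.
move=> q_gt1 /andP[le_qm le_mQ] b_gt0 S1 S2.
apply: (@leq_trans (2 * A1)); last by rewrite leq_mul2r q_gt1 orbT.
case: m S1 S2 le_qm le_mQ => [|k] S1 S2 le_qm le_mQ; first by lia.
have [d QE] : exists d, Q = k.+1 + d by exists (Q - k.+1); lia.
subst Q; simpl in S2.
(* The last factor is b * (Q - m + 1) + m - 2. *)
have bd : 0 < k.+1 * (b * d.+1 + k.-1) by lia.
rewrite -mulnn in S2.
have : k = k.-1.+1 by lia.
nia.
Qed.

(** With the same notation there are b * Q * Q - 1 nonzero forms, and
    A1 = m * (b * Q - 1) <= b * Q * Q - Q. *)
Lemma first_moment_lt (m b Q A1 : nat) :
    1 < Q -> 0 < m <= Q -> 0 < b ->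
    m + A1 = m * (b * Q) ->
  A1 < (b * Q * Q).-1.
Proof.
move=> Q_gt1 /andP[m_gt0 le_mQ] b_gt0 S1.
have [d QE] : exists d, Q = m + d by exists (Q - m); lia.
have : Q <= b * Q by rewrite leq_pmull.
have : m * (b * Q) + d * (b * Q) = b * Q * Q by rewrite {4}QE; nia.
nia.
Qed.

(** * Linear forms vanishing on a subspace *)

Section Restriction.
Variables (F : fieldType) (V : vectType F) (U : {vspace V}).

Definition restrict_form (f : 'Hom(V, F^o)) : 'Hom(subvs_of U, F^o) :=
  (f \o linfun vsval)%VF.

Fact restrict_form_linear : linear restrict_form.
Proof. by move=> c f g; rewrite /restrict_form comp_lfunDl comp_lfunZl. Qed.

HB.instance Definition _ := GRing.isSemilinear.Build F _ _ _ restrict_form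
  (GRing.semilinear_linear restrict_form_linear).

(** A form on [U] extends to [V] by composing it with a projection onto [U]. *)
Lemma restrict_form_surj : limg (linfun restrict_form) = fullv.
Proof.
apply/eqP; rewrite eqEsubv subvf; apply/subvP => g _.
suff -> : g = linfun restrict_form (g \o linfun (vsproj U))%VF.
  by rewrite memv_img ?memvf.
apply/lfunP => u; rewrite lfunE /= /restrict_form !comp_lfunE !lfunE /=.
by rewrite vsvalK.
Qed.

Lemma restrict_form_ker (f : 'Hom(V, F^o)) :
  (f \in lker (linfun restrict_form)) = (U <= lker f)%VS.
Proof.
rewrite memv_ker lfunE /=; apply/eqP/subvP => [f0 u uU | fU].
  have /lfunP/(_ (vsproj U u)) := f0.
  by rewrite comp_lfunE !lfunE /= vsprojK // memv_ker => ->.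
apply/lfunP => u; rewrite comp_lfunE !lfunE /=.
by apply/eqP; rewrite -memv_ker fU ?subvsP.
Qed.

Lemma dim_annihilator :
  \dim (lker (linfun restrict_form)) + \dim U = \dim {:V}.
Proof.
have := limg_ker_dim (linfun restrict_form) fullv.
rewrite capfv restrict_form_surj !dimvf /dim /= => H.
rewrite !muln1 in H.
exact: H.
Qed.
End Restriction.

(** * Counting points and forms over a finite field *)

Section Counting.
Variables (F : finFieldType) (V : vectType F).
Implicit Types (U W : {vspace V}).
Local Notation q := #|F|.
Local Notation dual := (finvect_type 'Hom(V, F^o)).

Lemma card_annihilator U :
  #|[set f : dual | (U <= lker f)%VS]| * q ^ \dim U = q ^ \dim {:V}.
Proof.
rewrite -(dim_annihilator U) expnD; congr (_ * _).
rewrite -(@card_vspace F dual); apply: eq_card => f.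
by rewrite inE -restrict_form_ker.
Qed.

Lemma card_dual : #|{: dual}| = q ^ \dim {:V}.
Proof.
rewrite -(card_annihilator 0%VS) dimv0 muln1.
by apply/esym/eq_card => f; rewrite !inE sub0v.
Qed.

(** [V] has to be destructed: the vector space structure carried by
    [finvect_type V] is convertible to that of [V] only when the latter is an
    explicit record. *)
Lemma card_vspace_set U : #|[set v : finvect_type V | v \in U]| = q ^ \dim U.
Proof.
rewrite cardsE; move: U; case: V => T cT U.
exact: (@card_vspace F (finvect_type (Vector.Pack cT)) cT U).
Qed.

(** If [f w = 1] for some [w] in [U], the points of [U] where [f] is 1 form
    the coset of [w] modulo the hyperplane [U :&: lker f] of [U]. *)
Lemma card_affine_section U (f : 'Hom(V, F^o)) : ~~ (U <= lker f)%VS ->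
  #|[set v : finvect_type V | (v \in U) && (f v == 1%R)]| = q ^ (\dim U).-1.
Proof.
move=> /subvPn[u uU]; rewrite memv_ker => fu0.
pose w : V := ((f u)^-1 *: u)%R.
have fw : f w = 1%R by rewrite linearZ /= [LHS]mulVf.
have wU : w \in U by rewrite memvZ.
have -> : (\dim U).-1 = \dim (U :&: lker f)%VS.
  rewrite -(limg_ker_dim f U).
  suff -> : \dim (f @: U)%VS = 1 by rewrite addn1.
  apply/eqP; rewrite eqn_leq; apply/andP; split.
    by rewrite (leq_trans (dimvS (subvf _))) // dimvf.
  rewrite lt0n dimv_eq0; apply/eqP => fU0.
  by have := memv_img f uU; rewrite fU0 memv0 (negPf fu0).
rewrite -card_vspace_set.
rewrite -[RHS](card_imset _ (@addrI (finvect_type V) w)).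
apply: eq_card => v; rewrite !inE; apply/idP/imsetP => [/andP[vU /eqP fv]|].
  have vwK : (v - w : V)%R \in (U :&: lker f)%VS.
    by rewrite memv_cap memv_ker linearB /= fv fw subrr eqxx andbT rpredB.
  by exists (v - w : V)%R; rewrite ?inE //= addrC subrK.
case=> z zK ->; have : (z : V) \in (U :&: lker f)%VS by rewrite inE in zK.
rewrite memv_cap memv_ker => /andP[zU /eqP fz].
by apply/andP; split; [exact: rpredD | rewrite (linearD f) /= fz fw addr0].
Qed.

(** Both sides count the points where [f] is 1: these are nonzero, so each
    lies in exactly one member of [P]. *)
Lemma hyperplane_partition_count (P : seq {vspace V}) (f : 'Hom(V, F^o)) :
    uniq P -> (forall v, exists2 U, U \in P & v \in U) ->
    {in P &, forall U W, U != W -> (U :&: W = 0)%VS} -> f != 0%R ->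
  \sum_(U <- P | ~~ (U <= lker f)%VS) q ^ (\dim U).-1 = q ^ (\dim {:V}).-1.
Proof.
move=> uP covP disjP f0.
have meet0 U W (v : V) :
    U \in P -> W \in P -> v \in U -> v \in W -> W != U -> v = 0%R.
  move=> UP WP vU vW WU; apply/eqP.
  by rewrite -memv0 -(disjP U W) 1?eq_sym // memv_cap vU vW.
have nker : ~~ (fullv <= lker f)%VS.
  apply: contra f0 => /subvP fV; apply/eqP/lfunP => v.
  by apply/eqP; rewrite lfunE -memv_ker fV ?memvf.
rewrite -(card_affine_section nker) -sum1dep_card [RHS]big_mkcond [LHS]big_mkcond /=.
have sec U : (if ~~ (U <= lker f)%VS then q ^ (\dim U).-1 else 0)
    = \sum_(v : finvect_type V) if (v \in U) && (f v == 1%R) then 1 else 0.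
  rewrite -big_mkcond sum1dep_card.
  case: ifPn => [/card_affine_section //|/negPn/subvP Uf].
  apply/esym/eqP; rewrite cards_eq0; apply/eqP/setP => v; rewrite !inE.
  by apply/andP => -[/Uf]; rewrite memv_ker => /eqP->; rewrite eq_sym oner_eq0.
under eq_bigr => U _ do rewrite sec.
rewrite exchange_big /=; apply: eq_bigr => v _; rewrite memvf.
case: eqP => [fv|_]; last by rewrite big1 // => U _; rewrite andbF.
have [U UP vU] := covP v.
rewrite (bigD1_seq U) //= vU big1_seq // => W /andP[WU WP].
case: ifP => // /andP[vW _].
have v0 := meet0 _ _ _ UP WP vU vW WU.
by move/eqP: fv; rewrite v0 linear0 eq_sym oner_eq0.
Qed.

(** Double counting of the pairs (form, subspace in [T] on which it vanishes).
    The powers of [q] are moved to the left-hand side to avoid a truncated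
    subtraction in the exponent. *)
Lemma first_moment (T : seq {vspace V}) (t : nat) :
    {in T, forall U, \dim U = t} ->
  (\sum_(f : dual) count (fun U => U <= lker f)%VS T) * q ^ t
    = size T * q ^ \dim {:V}.
Proof.
move=> dimT.
under eq_bigr => f _ do rewrite -sum1_count big_mkcond.
rewrite exchange_big /= big_distrl /= -sum1_size big_distrl /=.
apply: eq_big_seq => U UT.
by rewrite -big_mkcond sum1_card -(card_annihilator U) dimT // cardsE mul1n.
Qed.

(** Double counting of the triples (form, U, W) such that the form vanishes on
    U + W; this sum has dimension t if U = W and 2t otherwise. *)
Lemma second_moment (T : seq {vspace V}) (t : nat) :
    uniq T -> {in T, forall U, \dim U = t} ->
    {in T &, forall U W, U != W -> (U :&: W = 0)%VS} ->
  (\sum_(f : dual) count (fun U => U <= lker f)%VS T ^ 2) * q ^ t.*2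
    = size T * (q ^ t + (size T).-1) * q ^ \dim {:V}.
Proof.
move=> uT dimT disjT.
pose ann U := #|[set f : dual | (U <= lker f)%VS]|.
have -> : \sum_(f : dual) count (fun U => U <= lker f)%VS T ^ 2
    = \sum_(U <- T) \sum_(W <- T) ann (U + W)%VS.
  under [LHS]eq_bigr => f _ do rewrite -mulnn -sum1_count big_mkcond big_distrlr.
  rewrite exchange_big; apply: eq_bigr => U _.
  rewrite exchange_big; apply: eq_bigr => W _ /=.
  rewrite /ann -sum1dep_card [RHS]big_mkcond; apply: eq_bigr => f _.
  by rewrite subv_add; do 2!case: (_ <= _)%VS.
have sum_const (s : seq {vspace V}) c : \sum_(U <- s) c = size s * c.
  by rewrite big_const_seq iter_addn_0 count_predT mulnC.
rewrite -mulnA -sum_const big_distrl /=.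
apply: eq_big_seq => U UT.
rewrite (bigD1_seq U) //= addvv mulnDl mulnDl; congr (_ + _).
  by rewrite -addnn expnD mulnA -(card_annihilator U) dimT // [RHS]mulnC.
rewrite -(size_rem UT) -sum_const big_distrl /= rem_filter // big_filter.
rewrite big_seq_cond [RHS]big_seq_cond; apply: eq_bigr => W /andP[WT WU].
rewrite -(card_annihilator (U + W)%VS) dimv_disjoint_sum ?dimT ?addnn //.
by rewrite disjT // eq_sym.
Qed.

(** In [hyperplane_partition_count] every term with dim U > t, as well as the
    total, is divisible by q ^ t, and the other terms all equal q ^ (t - 1). *)
Lemma dvdn_tail_outside (P : seq {vspace V}) (t : nat) (f : 'Hom(V, F^o)) :
    uniq P -> (forall v, exists2 U, U \in P & v \in U) ->
    {in P &, forall U W, U != W -> (U :&: W = 0)%VS} ->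
    0 < t < \dim {:V} -> {in P, forall U, t <= \dim U} -> f != 0%R ->
  q %| count (fun U => ~~ (U <= lker f)%VS) [seq U <- P | \dim U == t].
Proof.
move=> uP covP disjP /andP[t_gt0 lt_tn] minP f0.
have q_gt0 : 0 < q by rewrite ltnW // finNzRing_gt1.
have := hyperplane_partition_count uP covP disjP f0.
rewrite (bigID (fun U => \dim U == t)) /=.
rewrite (eq_bigr (fun=> q ^ t.-1)); last by move=> U /andP[_ /eqP->].
rewrite big_const_seq iter_addn_0 => countE.
have dvd_n : q ^ t %| q ^ (\dim {:V}).-1 by apply: dvdn_exp2l; lia.
rewrite -countE dvdn_addl in dvd_n; last first.
  rewrite big_seq_cond; apply: dvdn_sum => U /and3P[UP _ Ut].
  apply: dvdn_exp2l; have := minP _ UP; lia.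
rewrite count_filter; move: dvd_n.
by rewrite -{1}(prednK t_gt0) expnSr dvdn_pmul2l ?expn_gt0 ?q_gt0.
Qed.

(** * The lower bound on the number of smallest components *)

(** The number of members of [T] inside the kernel of a nonzero form is
    constant modulo [q], so it either never vanishes or is always a multiple
    of [q]; the first and second moments rule out these cases respectively
    when [T] has at most q ^ t members. *)
Lemma divisible_spread_gt (T : seq {vspace V}) (t : nat) :
    uniq T -> {in T, forall U, \dim U = t} ->
    {in T &, forall U W, U != W -> (U :&: W = 0)%VS} ->
    0 < size T -> 0 < t -> t.*2 <= \dim {:V} ->
    (forall f : 'Hom(V, F^o), f != 0%R ->
       q %| count (fun U => ~~ (U <= lker f)%VS) T) ->
  q ^ t < size T.
Proof.
move=> uT dimT disjT T_gt0 t_gt0 le_2tn dvdT.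
set m := size T in T_gt0 *.
pose x (f : dual) := count (fun U => U <= lker f)%VS T.
have q_gt1 : 1 < q := finNzRing_gt1 F.
have Q_gt1 : 1 < q ^ t by rewrite -{1}(exp1n t) ltn_exp2r.
pose b := q ^ (\dim {:V} - t.*2).
have b_gt0 : 0 < b by rewrite expn_gt0 ltnW.
have NE : q ^ \dim {:V} = b * q ^ t * q ^ t.
  by rewrite -!expnD; congr (_ ^ _); lia.
have Q_gt0 := ltnW Q_gt1.
have S1 : \sum_f x f = m * (b * q ^ t).
  have := first_moment dimT; rewrite NE mulnA => /eqP.
  by rewrite eqn_pmul2r // => /eqP.
have S2 : \sum_f x f ^ 2 = m * (q ^ t + m.-1) * b.
  have := second_moment uT dimT disjT; rewrite NE -addnn expnD !mulnA => /eqP.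
  by rewrite !eqn_pmul2r // => /eqP.
have x0 : x 0%R = m.
  apply/eqP; rewrite -all_count; apply/allP => U _.
  by apply/subvP => v _; rewrite memv_ker lfunE.
rewrite (bigD1 (0%R : dual)) //= x0 in S1.
rewrite (bigD1 (0%R : dual)) //= x0 in S2.
have xE f : f != 0%R -> x f = m %[mod q].
  move=> /dvdT /dvdnP[k outE].
  by rewrite /m -(count_predC (fun U => U <= lker f)%VS) outE addnC modnMDl.
rewrite ltnNge; apply/negP => le_mQ.
have [dvd_qm | ndvd_qm] := boolP (q %| m).
  have x_sq f : f != 0%R -> q * x f <= x f ^ 2.
    move=> /xE /eqP; rewrite (eqP dvd_qm) => /dvdn_leq.
    by case: (x f) => [|k] qx; rewrite ?muln0 // -mulnn leq_pmul2r // qx.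
  have: q * \sum_(f : dual | f != 0%R) x f <= \sum_(f : dual | f != 0%R) x f ^ 2.
    by rewrite big_distrr; apply: leq_sum.
  have le_qm : q <= m by exact: dvdn_leq.
  by rewrite leqNgt (second_moment_lt q_gt1 _ b_gt0 S1 S2) ?le_qm.
have x_gt0 f : f != 0%R -> 0 < x f.
  move=> /xE xm; rewrite lt0n; apply: contra ndvd_qm => /eqP x_0.
  by rewrite /dvdn -xm x_0 mod0n.
have : \sum_(f : dual | f != 0%R) 1 <= \sum_(f : dual | f != 0%R) x f.
  exact: leq_sum.
rewrite sum1_card cardC1 card_dual NE leqNgt.
by rewrite (first_moment_lt Q_gt1 _ b_gt0 S1) ?T_gt0.
Qed.
End Counting.

Unset Implicit Arguments.
Local Open Scope fset_scope.

Theorem corollary3p4 (q n : nat) (F : finFieldType) (V : vectType F)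
    (P : {fset {vspace V}}) (t : nat)
    (hq : #|F| = q) (hV : \dim {:V} = n) (hn : 1 < n)
    (hP : nontrivial_partition P) (ht : is_min_dim P t) :
  q + t <= #|` [fset U in P | \dim U == t] |.
Proof.
case: hP ht => -[nzP covP disjP] P_ge2 [[U0 U0P dimU0] minP]; subst q.
have uP : uniq P by exact: fset_uniq.
have disj : {in P &, forall U W, U != W -> (U :&: W = 0)%VS}.
  by move=> U W UP WP /eqP; apply: disjP.
have t_gt0 : 0 < t by rewrite -dimU0 lt0n dimv_eq0; apply/eqP/nzP.
(* A second component makes V large enough, n >= 2t. *)
have [W WP WU0] : exists2 W, W \in P & W != U0.
  have : 0 < #|` P `\ U0| by move: P_ge2; rewrite (cardfsD1 U0) U0P.
  by rewrite cardfs_gt0 => /fset0Pn[W]; rewrite !inE => /andP[WU WP]; exists W.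
have le_2tn : t.*2 <= \dim {:V}.
  rewrite (leq_trans _ (dimvS (subvf (U0 + W)))) // dimv_disjoint_sum.
    by rewrite -addnn leq_add ?minP.
  by rewrite disj // eq_sym.
pose T := [seq U <- P | \dim U == t].
have -> : #|` [fset U in P | \dim U == t] | = size T.
  apply/perm_size/uniq_perm; rewrite ?fset_uniq ?filter_uniq // => U.
  by rewrite !inE mem_filter andbC.
have TP : {subset T <= P} by move=> U; rewrite mem_filter => /andP[].
have lt_QT : #|F| ^ t < size T.
  apply: divisible_spread_gt; rewrite ?filter_uniq //.
  - by move=> U; rewrite mem_filter => /andP[/eqP].
  - by move=> U U' /TP UP /TP UP'; apply: disj.
  - by rewrite size_filter -has_count; apply/hasP; exists U0; rewrite ?dimU0.
  - by move=> f; apply: dvdn_tail_outside => //; lia.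
apply: leq_trans lt_QT.
have q_gt1 := finNzRing_gt1 F.
move: #|F| q_gt1 => q q_gt1.
elim: t t_gt0 {dimU0 minP le_2tn T TP} => // -[|t] IH _; first by rewrite addn1.
rewrite expnS; have := IH isT; nia.
Qed.
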